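(* Let $(\mathcal C,p)$ be a universe category with universe $p:\widetilde U\to U$, where $\mathcal C$ is locally cartesian closed and has a binary product structure. Let $CC=CC(\mathcal C,p)$ and $n\ge1$. Then the compositions $$\mu_n=u_n\circ int^\circ(\eta_{n-1,U}):\ \mathcal{O}b_n\to int^{\circ}(Yo(I_p^{n-1}(U))),$$ $$\widetilde\mu_n=\widetilde u_n\circ int^\circ(\eta_{n-1,\widetilde U}):\ \widetilde{\mathcal{O}b}_n\to int^{\circ}(Yo(I_p^{n-1}(\widetilde U)))$$ are isomorphisms of presheaves on $CC$, and $$\widetilde\mu_n\circ int^{\circ}(Yo(I_p^{n-1}(p)))=\partial\circ\mu_n$$ as morphisms $\widetilde{\mathcal{O}b}_n\to int^\circ(Yo(I_p^{n-1}(U)))$.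
   Context: Conventions. Composition is written in diagrammatic order: for $f:X\to Y$, $g:Y\to Z$ the composite is $f\circ g:X\to Z$. $\amalg_{i\in I}A_i$ denotes the set of pairs $(i,a)$, $i\in I$, $a\in A_i$. $Yo$ is the Yoneda embedding, $Yo(Y)(X)=Mor(X,Y)$. For a functor $\Phi:C\to C'$ and a presheaf $\mathcal G$ on $C'$, $\Phi^{\circ}(\mathcal G)(X)=\mathcal G(\Phi(X))$; $\Phi^\circ$ is a functor on presheaves. For a morphism $p:Y\to X$, $sec(p)=\{s:X\to Y\mid s\circ p=Id_X\}$. Universes. A universe in a category $\mathcal C$ is a morphism $p:\widetilde U\to U$ with a choice, for every $F:X\to U$, of a pullback square with vertex $(X;F)$ and projections $p_F:(X;F)\to X$, $Q(F):(X;F)\to\widetilde U$, $p_F\circ F=Q(F)\circ p$. For $f:X'\to X$ and $F:X\to U$, $Q(f,F):(X';f\circ F)\to(X;F)$ is the unique morphism with $Q(f,F)\circ p_F=p_{f\circ F}\circ f$ and $Q(f,F)\circ Q(F)=Q(f\circ F)$. A universe category $(\mathcal C,p)$ is a category with a universe $p$ and a chosen final object $pt$. The functor $D_p:PreShv(\mathcal C)\to PreShv(\mathcal C)$. $D_p(\mathcal G)(X)=\amalg_{F:X\to U}\mathcal G((X;F))$; for $f:X'\to X$, $D_p(\mathcal G)(f)(F,\gamma)=(f\circ F,\mathcal G(Q(f,F))(\gamma))$; for $r:\mathcal G\to\mathcal G'$, $D_p(r)_X(F,\gamma)=(F,r_{(X;F)}(\gamma))$. $D_p^n$ is its $n$-th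 iterate. The C-system $CC(\mathcal C,p)$. Define recursively sets $Ob_n(\mathcal C,p)$ and functions $int:Ob_n(\mathcal C,p)\to Ob(\mathcal C)$: $Ob_0(\mathcal C,p)=\{tt\}$, $int(tt)=pt$; $Ob_{n+1}(\mathcal C,p)=\amalg_{A\in Ob_n(\mathcal C,p)}Mor_{\mathcal C}(int(A),U)$, $int(A,F)=(int(A);F)$. Objects of $CC(\mathcal C,p)$ are pairs $\Gamma=(n,A)$ with $A\in Ob_n(\mathcal C,p)$, and $int(\Gamma)=int(A)$. Morphisms $\Gamma'\to\Gamma$ are (copies of) the morphisms $int(\Gamma')\to int(\Gamma)$ of $\mathcal C$, so that $int:CC(\mathcal C,p)\to\mathcal C$ is a fully faithful functor. Set $l(n,A)=n$, $ft(n+1,(A,F))=(n,A)$, $ft(0,tt)=(0,tt)$; for $T=(n+1,(A,F))$, $p_T:T\to ft(T)$ is the morphism with $int(p_T)=p_F$; for such $T$ and $f:(n',A')\to(n,A)$, $f^*(T)=(n'+1,(A',int(f)\circ F))$ and $q(f,T):f^*(T)\to T$ is the morphism with $int(q(f,T))=Q(int(f),F)$. The squares $p_{f^*(T)}\circ f=q(f,T)\circ p_T$ are pullbacks. Presheaves on $CC(\mathcal C,p)$. $\mathcal{O}b_n(\Gamma)=\{T\mid l(T)=l(\Gamma)+n,\ ft^n(T)=\Gamma\}$. For $f:\Gamma'\to\Gamma$ and $T\in\mathcal{O}b_n(\Gamma)$ define recursively in $n$: for $n=0$, $f^*(T)=\Gamma'$, $q(f,T)=f$; for $n\ge1$, $f^*(T)=q(f,ft(T))^*(T)$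 and $q(f,T)=q(q(f,ft(T)),T)$; then $\mathcal{O}b_n(f)(T)=f^*(T)$. For $n\ge1$, $\widetilde{\mathcal{O}b}_n(\Gamma)$ is the set of morphisms $o$ with $\partial(o):=codom(o)\in\mathcal{O}b_n(\Gamma)$ and $o\in sec(p_{\partial(o)})$; for $f:\Gamma'\to\Gamma$, $\widetilde{\mathcal{O}b}_n(f)(o)=f^*(o)$ is the unique element of $sec(p_{f^*(\partial(o))})$ with $f^*(o)\circ q(f,\partial(o))=q(f,ft(\partial(o)))\circ o$. The map $o\mapsto\partial(o)$ is a morphism of presheaves $\partial:\widetilde{\mathcal{O}b}_n\to\mathcal{O}b_n$. The isomorphisms $u_n:\mathcal{O}b_n\to int^\circ(D_p^{n-1}(Yo(U)))$ and $\widetilde u_n:\widetilde{\mathcal{O}b}_n\to int^\circ(D_p^{n-1}(Yo(\widetilde U)))$, $n\ge1$: for $\Gamma=(n,A)$ and $T=(n+1,(A,F))$, $u_{1,\Gamma}(T)=F$; $\widetilde u_{1,\Gamma}(o)=int(o)\circ Q(u_{1,\Gamma}(\partial(o)))$; and for $m\ge1$, $u_{m+1,\Gamma}(T)=(u_{1,\Gamma}(ft^m(T)),u_{m,ft^m(T)}(T))$, $\widetilde u_{m+1,\Gamma}(o)=(u_{1,\Gamma}(ft^m(\partial(o))),\widetilde u_{m,ft^m(\partial(o))}(o))$. (Note $int(T)=(int(\Gamma);u_{1,\Gamma}(T))$ for $T\in\mathcal{O}b_1(\Gamma)$.) Locally cartesian closed structure, $I_p$ and $\eta_n$. A binary product structure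 on $\mathcal C$ is a choice of binary products $X\times Y$ with projections $pr_1,pr_2$. A locally cartesian closed structure is a choice, in each slice $\mathcal C/Z$, of binary products $(X,f)\times_Z(Y,g)$ and of internal-hom objects $\underline{Hom}_Z((X,f),(Y,g))$ with evaluation morphisms $ev:\underline{Hom}_Z((X,f),(Y,g))\times_Z(X,f)\to(Y,g)$ such that $u\mapsto(u\times_Z Id)\circ ev$ is a bijection $Mor_Z((W,h),\underline{Hom}_Z((X,f),(Y,g)))\to Mor_Z((W,h)\times_Z(X,f),(Y,g))$; for $b:(Y,g)\to(Y',g')$ over $Z$, $\underline{Hom}_Z((X,f),b)$ is the unique morphism over $Z$ with $(\underline{Hom}_Z((X,f),b)\times_Z Id)\circ ev=ev\circ b$. No compatibility with the universe structure on $p$ is assumed. Set $I_p(Y)=\underline{Hom}_U((\widetilde U,p),(U\times Y,pr_1))$, with structure morphism $prI_p(Y):I_p(Y)\to U$ and evaluation $evI_p(Y):(I_p(Y),prI_p(Y))\times_U(\widetilde U,p)\to U\times Y$; for $f:Y\to Y'$, $I_p(f)=\underline{Hom}_U((\widetilde U,p),Id_U\times f)$. This makes $I_p$ a functor $\mathcal C\to\mathcal C$; $I_p^n$ is its $n$-th iterate. For $F:X\to U$ let $\iota_F:(X;F)\to(X,F)\times_U(\widetilde U,p)$ be the unique morphism with $\iota_F\circ pr_1=p_F$, $\iota_F\circ pr_2=Q(F)$. Set $st_p(Y)=\iota_{prI_p(Y)}\circ evI_p(Y)\circ pr_2:(I_p(Y);prI_p(Y))\to Y$. The isomorphism of presheaves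 $\eta_Y:D_p(Yo(Y))\to Yo(I_p(Y))$ is the one whose inverse is, at $X$, the bijection $g\mapsto(g\circ prI_p(Y),Q(g,prI_p(Y))\circ st_p(Y))$ from $Mor_{\mathcal C}(X,I_p(Y))$. The isomorphisms $\eta_{n,Y}:D_p^n(Yo(Y))\to Yo(I_p^n(Y))$ are given by $\eta_{0,Y}=Id$, $\eta_{n+1,Y}=D_p(\eta_{n,Y})\circ\eta_{I_p^n(Y)}$. *)

(* Defs.v *)
From Stdlib Require Import ssreflect PeanoNat Lia.
From Stdlib Require Import ProofIrrelevance.

Set Implicit Arguments.
Unset Strict Implicit.
Unset Printing Implicit Defensive.

Declare Scope cat_scope.
Open Scope cat_scope.

#[local] Obligation Tactic := try by [].

Record Category := {
  Obj :> Type;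
  Hom : Obj -> Obj -> Type;
  idc : forall X, Hom X X;
  comp : forall X Y Z, Hom X Y -> Hom Y Z -> Hom X Z;
  comp1f : forall X Y (f : Hom X Y), comp (idc X) f = f;
  compf1 : forall X Y (f : Hom X Y), comp f (idc Y) = f;
  compA : forall X Y Z W (f : Hom X Y) (g : Hom Y Z) (h : Hom Z W),
    comp f (comp g h) = comp (comp f g) h
}.
Arguments Hom {_} _ _.
Arguments idc {_} _.
Arguments comp {_ _ _ _} _ _.
Arguments comp1f {_ _ _} _.
Arguments compf1 {_ _ _} _.
Arguments compA {_ _ _ _ _} _ _ _.

(* Composition is in diagrammatic order throughout. *)
Notation "f >> g" := (comp f g) (at level 40, left associativity) : cat_scope.

(* The identity, read as a morphism between two equal objects. *)
Definition idto (C : Category) (X Y : C) (e : X = Y) : Hom X Y :=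
  eq_rect X (fun Z => Hom X Z) (idc X) Y e.

Record Functor (C D : Category) := {
  fob :> C -> D;
  fmap : forall X Y : C, Hom X Y -> Hom (fob X) (fob Y);
  fmap_id : forall X : C, fmap (idc X) = idc (fob X);
  fmap_comp : forall (X Y Z : C) (f : Hom X Y) (g : Hom Y Z),
    fmap (f >> g) = fmap f >> fmap g
}.
Arguments fmap {C D} _ {X Y} _.

Program Definition functor_id (C : Category) : Functor C C :=
  {| fob := fun X => X; fmap := fun X Y f => f |}.

Program Definition functor_comp (C D E : Category)
    (F : Functor C D) (G : Functor D E) : Functor C E :=
  {| fob := fun X => G (F X); fmap := fun X Y f => fmap G (fmap F f) |}.
Next Obligation. by move=> * /=; rewrite !fmap_id. Qed.
Next Obligation. by move=> * /=; rewrite !fmap_comp. Qed.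

Record Presheaf (C : Category) := {
  psh :> C -> Type;
  act : forall X' X : C, Hom X' X -> psh X -> psh X';
  act_id : forall (X : C) (x : psh X), act (idc X) x = x;
  act_comp : forall (X'' X' X : C) (g : Hom X'' X') (f : Hom X' X) (x : psh X),
    act (g >> f) x = act g (act f x)
}.
Arguments act {C} _ {X' X} _ _.

Record PshMor (C : Category) (P Q : Presheaf C) := {
  pmor :> forall X : C, P X -> Q X;
  pmor_nat : forall (X' X : C) (f : Hom X' X) (x : P X),
    pmor (act P f x) = act Q f (pmor x)
}.

Definition psh_id (C : Category) (P : Presheaf C) : PshMor P P :=
  {| pmor := fun X x => x; pmor_nat := fun _ _ _ _ => eq_refl |}.

Program Definition psh_comp (C : Category) (P Q R : Presheaf C)
    (r : PshMor P Q) (s : PshMor Q R) : PshMor P R :=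
  {| pmor := fun X x => s X (r X x) |}.
Next Obligation. by move=> * /=; rewrite !pmor_nat. Qed.

Notation "r >>> s" := (psh_comp r s) (at level 40, left associativity) : cat_scope.

Definition is_psh_iso (C : Category) (P Q : Presheaf C) (r : PshMor P Q) : Prop :=
  exists s : PshMor Q P, r >>> s = psh_id P /\ s >>> r = psh_id Q.

Record Bij (A B : Type) (f : A -> B) := {
  binv : B -> A;
  bijK : forall a, binv (f a) = a;
  binvK : forall b, f (binv b) = b
}.

Program Definition psh_inv (C : Category) (P Q : Presheaf C) (r : PshMor P Q)
    (b : forall X, Bij (r X)) : PshMor Q P :=
  {| pmor := fun X => binv (b X) |}.
Next Obligation.
by move=> C P Q r b X' X f x; rewrite -{1}(binvK (b X) x) -pmor_nat bijK.
Qed.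

Program Definition Yo (C : Category) (Y : C) : Presheaf C :=
  {| psh := fun X => Hom X Y; act := fun X' X f g => f >> g |}.
Next Obligation. by move=> * /=; rewrite comp1f. Qed.
Next Obligation. by move=> * /=; rewrite compA. Qed.

Program Definition Yo_map (C : Category) (Y Y' : C) (f : Hom Y Y') :
    PshMor (Yo Y) (Yo Y') :=
  {| pmor := fun X g => g >> f |}.
Next Obligation. by move=> * /=; rewrite compA. Qed.

(* pre Phi G is Phi^o(G) = G o Phi, and pre_map its action on morphisms. *)
Program Definition pre (C D : Category) (Phi : Functor C D) (G : Presheaf D) :
    Presheaf C :=
  {| psh := fun X => G (Phi X); act := fun X' X f => act G (fmap Phi f) |}.
Next Obligation. by move=> * /=; rewrite fmap_id act_id. Qed.
Next Obligation. by move=> * /=; rewrite fmap_comp act_comp. Qed.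

Program Definition pre_map (C D : Category) (Phi : Functor C D)
    (G G' : Presheaf D) (r : PshMor G G') : PshMor (pre Phi G) (pre Phi G') :=
  {| pmor := fun X => r (Phi X) |}.
Next Obligation. by move=> * /=; rewrite pmor_nat. Qed.

Definition sec (C : Category) (X Y : C) (p : Hom Y X) : Type :=
  {s : Hom X Y | s >> p = idc X}.

(* In the structures below the mediating morphisms are recorded as
   operations; being unique, they add no data beyond the chosen objects and
   projections. *)

Record FinalObject (C : Category) := {
  pt : C;
  to_pt : forall X : C, Hom X pt;
  to_pt_uniq : forall (X : C) (f g : Hom X pt), f = g
}.

Record Pullback (C : Category) (X Y Z : C) (f : Hom X Z) (g : Hom Y Z) := {
  pb_ob : C;
  pb1 : Hom pb_ob X;
  pb2 : Hom pb_ob Y;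
  pb_comm : pb1 >> f = pb2 >> g;
  pb_lift : forall (W : C) (a : Hom W X) (b : Hom W Y),
    a >> f = b >> g -> Hom W pb_ob;
  pb_lift1 : forall W (a : Hom W X) (b : Hom W Y) (e : a >> f = b >> g),
    pb_lift e >> pb1 = a;
  pb_lift2 : forall W (a : Hom W X) (b : Hom W Y) (e : a >> f = b >> g),
    pb_lift e >> pb2 = b;
  pb_uniq : forall (W : C) (h h' : Hom W pb_ob),
    h >> pb1 = h' >> pb1 -> h >> pb2 = h' >> pb2 -> h = h'
}.

Record BinProduct (C : Category) (X Y : C) := {
  prod_ob : C;
  pr1 : Hom prod_ob X;
  pr2 : Hom prod_ob Y;
  pair : forall W : C, Hom W X -> Hom W Y -> Hom W prod_ob;
  pair1 : forall W (a : Hom W X) (b : Hom W Y), pair a b >> pr1 = a;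
  pair2 : forall W (a : Hom W X) (b : Hom W Y), pair a b >> pr2 = b;
  pair_uniq : forall (W : C) (h h' : Hom W prod_ob),
    h >> pr1 = h' >> pr1 -> h >> pr2 = h' >> pr2 -> h = h'
}.

Definition BinProducts (C : Category) : Type := forall X Y : C, BinProduct X Y.

Definition prod_map (C : Category) (P : BinProducts C) (X X' Y Y' : C)
    (f : Hom X X') (g : Hom Y Y') : Hom (prod_ob (P X Y)) (prod_ob (P X' Y')) :=
  pair (P X' Y') (pr1 (P X Y) >> f) (pr2 (P X Y) >> g).

Record InternalHoms (C : Category) (P : BinProducts C) := {
  ihom : C -> C -> C;
  ev : forall X Y : C, Hom (prod_ob (P (ihom X Y) X)) Y;
  ihom_bij : forall W X Y : C,
    Bij (fun u : Hom W (ihom X Y) => prod_map P u (idc X) >> ev X Y)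
}.
Arguments ihom {C P} _ _ _.
Arguments ev {C P} _ _ _.
Arguments ihom_bij {C P} _ _ _ _.

(* The unique morphism with (ihom_map b x Id) >> ev = ev >> b. *)
Definition ihom_map (C : Category) (P : BinProducts C) (H : InternalHoms P)
    (X Y Y' : C) (b : Hom Y Y') : Hom (ihom H X Y) (ihom H X Y') :=
  binv (ihom_bij H (ihom H X Y) X Y') (ev H X Y >> b).

Section IhomMap.
Variables (C : Category) (P : BinProducts C) (H : InternalHoms P).

Lemma prod_map_id (X Y : C) :
  prod_map P (idc X) (idc Y) = idc (prod_ob (P X Y)).
Proof. by apply: (@pair_uniq _ _ _ (P X Y)); rewrite ?pair1 ?pair2 ?comp1f ?compf1. Qed.

Lemma prod_map_comp (X X' X'' Y Y' Y'' : C) (f : Hom X X') (f' : Hom X' X'')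
    (g : Hom Y Y') (g' : Hom Y' Y'') :
  prod_map P (f >> f') (g >> g') = prod_map P f g >> prod_map P f' g'.
Proof.
apply: (@pair_uniq _ _ _ (P X'' Y'')).
  by rewrite -compA !pair1 !compA pair1.
by rewrite -compA !pair2 !compA pair2.
Qed.

Lemma ihom_inj (W X Y : C) (u u' : Hom W (ihom H X Y)) :
  prod_map P u (idc X) >> ev H X Y = prod_map P u' (idc X) >> ev H X Y -> u = u'.
Proof.
move=> e; rewrite -(bijK (ihom_bij H W X Y) u) -(bijK (ihom_bij H W X Y) u').
by rewrite e.
Qed.

Lemma ihom_map_ev (X Y Y' : C) (b : Hom Y Y') :
  prod_map P (ihom_map H X b) (idc X) >> ev H X Y' = ev H X Y >> b.
Proof. exact: (binvK (ihom_bij H _ X Y') (ev H X Y >> b)). Qed.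

Lemma ihom_map_id (X Y : C) : ihom_map H X (idc Y) = idc (ihom H X Y).
Proof.
by apply: ihom_inj; rewrite ihom_map_ev prod_map_id comp1f compf1.
Qed.

Lemma ihom_map_comp (X Y Y' Y'' : C) (b : Hom Y Y') (b' : Hom Y' Y'') :
  ihom_map H X (b >> b') = ihom_map H X b >> ihom_map H X b'.
Proof.
apply: ihom_inj; rewrite ihom_map_ev -(comp1f (idc X)) prod_map_comp.
by rewrite -(compA (prod_map _ _ _)) ihom_map_ev !compA ihom_map_ev.
Qed.

End IhomMap.

Section Slice.
Variables (C : Category) (Z : C).

#[local] Set Primitive Projections.
Record SliceOb := { sob : C; sarr : Hom sob Z }.
#[local] Unset Primitive Projections.

Record SliceHom (A B : SliceOb) := {
  shom : Hom (sob A) (sob B);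
  shom_over : shom >> sarr B = sarr A
}.

Lemma SliceHom_eq (A B : SliceOb) (f g : SliceHom A B) :
  shom f = shom g -> f = g.
Proof.
case: f g => f ef [g eg] /= e; subst g; f_equal; exact: proof_irrelevance.
Qed.

Program Definition Slice : Category := {|
  Obj := SliceOb;
  Hom := SliceHom;
  idc := fun A => {| shom := idc (sob A) |};
  comp := fun A B D f g => {| shom := shom f >> shom g |}
|}.
Next Obligation. by move=> A; rewrite comp1f. Qed.
Next Obligation. by move=> A B D f g; rewrite -compA !shom_over. Qed.
Next Obligation. by move=> A B f; apply: SliceHom_eq; rewrite /= comp1f. Qed.
Next Obligation. by move=> A B f; apply: SliceHom_eq; rewrite /= compf1. Qed.
Next Obligation. by move=> *; apply: SliceHom_eq; rewrite /= compA. Qed.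

End Slice.

(* No relation to the pullbacks chosen in a universe, nor to chosen products
   of the ambient category, is required. *)
Record LCCStructure (C : Category) := {
  lcc_prod : forall Z : C, BinProducts (Slice Z);
  lcc_hom : forall Z : C, InternalHoms (@lcc_prod Z)
}.
Arguments lcc_prod {C} _ Z _ _.
Arguments lcc_hom {C} _ Z.

Record Universe (C : Category) := {
  Ut : C;
  U : C;
  up : Hom Ut U;
  upb : forall (X : C) (F : Hom X U), Pullback F up
}.
Arguments upb {C} _ {X} F.

Section WithUniverse.
Variables (C : Category) (p : Universe C).

(* ext F is the vertex (X;F) of the chosen pullback square, with projections
   pF F and QF F. *)
Definition ext (X : C) (F : Hom X (U p)) : C := pb_ob (upb p F).
Definition pF (X : C) (F : Hom X (U p)) : Hom (ext F) X := pb1 (upb p F).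
Definition QF (X : C) (F : Hom X (U p)) : Hom (ext F) (Ut p) := pb2 (upb p F).

Lemma Q_subproof (X' X : C) (f : Hom X' X) (F : Hom X (U p)) :
  (pF (f >> F) >> f) >> F = QF (f >> F) >> up p.
Proof. by rewrite -compA; exact: pb_comm. Qed.

Definition Q (X' X : C) (f : Hom X' X) (F : Hom X (U p)) :
    Hom (ext (f >> F)) (ext F) :=
  pb_lift (upb p F) (Q_subproof f F).

Lemma Q_pF (X' X : C) (f : Hom X' X) (F : Hom X (U p)) :
  Q f F >> pF F = pF (f >> F) >> f.
Proof. exact: pb_lift1. Qed.

Lemma Q_QF (X' X : C) (f : Hom X' X) (F : Hom X (U p)) :
  Q f F >> QF F = QF (f >> F).
Proof. exact: pb_lift2. Qed.

Lemma Q2_pF (X'' X' X : C) (g : Hom X'' X') (f : Hom X' X) (F : Hom X (U p)) :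
  Q g (f >> F) >> Q f F >> pF F = pF (g >> (f >> F)) >> (g >> f).
Proof. by rewrite -(compA (Q _ _)) Q_pF (compA (Q _ _)) Q_pF -(compA (pF _)). Qed.

Lemma Q2_QF (X'' X' X : C) (g : Hom X'' X') (f : Hom X' X) (F : Hom X (U p)) :
  Q g (f >> F) >> Q f F >> QF F = QF (g >> (f >> F)).
Proof. by rewrite -compA !Q_QF. Qed.

Lemma ext_uniq (W X : C) (F : Hom X (U p)) (h h' : Hom W (ext F)) :
  h >> pF F = h' >> pF F -> h >> QF F = h' >> QF F -> h = h'.
Proof. exact: pb_uniq. Qed.

Section DpOb.
Variable G : Presheaf C.

Lemma Dp_eq (X X0 : C) (F F' : Hom X (U p)) (F0 : Hom X0 (U p)) (a : Hom X X0)
    (h : Hom (ext F) (ext F0)) (h' : Hom (ext F') (ext F0)) (x : G (ext F0)) :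
  F = F' ->
  h >> pF F0 = pF F >> a -> h' >> pF F0 = pF F' >> a ->
  h >> QF F0 = QF F -> h' >> QF F0 = QF F' ->
  existT (fun F => G (ext F)) F (act G h x) = existT _ F' (act G h' x).
Proof.
move=> e; subst F' => e1 e2 e3 e4.
by rewrite (_ : h = h') //; apply: ext_uniq; rewrite ?e1 ?e2 ?e3 ?e4.
Qed.

Program Definition Dp : Presheaf C := {|
  psh := fun X => {F : Hom X (U p) & G (ext F)};
  act := fun X' X f x =>
    existT _ (f >> projT1 x) (act G (Q f (projT1 x)) (projT2 x))
|}.
Next Obligation.
move=> X [F x] /=; rewrite -{2}(act_id x).
by apply: (@Dp_eq _ _ _ _ _ (idc X)); rewrite ?comp1f ?compf1 ?Q_pF ?Q_QF ?compf1.
Qed.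
Next Obligation.
move=> X'' X' X g f [F x] /=; rewrite -act_comp.
apply: (@Dp_eq _ _ _ _ _ (g >> f)).
- by rewrite compA.
- exact: Q_pF.
- exact: Q2_pF.
- exact: Q_QF.
- exact: Q2_QF.
Qed.

End DpOb.

Program Definition Dp_map (G G' : Presheaf C) (r : PshMor G G') :
    PshMor (Dp G) (Dp G') :=
  {| pmor := fun X x => existT _ (projT1 x) (r (ext (projT1 x)) (projT2 x)) |}.
Next Obligation. by move=> G G' r X' X f [F x] /=; rewrite pmor_nat. Qed.

Fixpoint Dpn (n : nat) (G : Presheaf C) : Presheaf C :=
  match n with
  | 0 => G
  | S m => Dp (Dpn m G)
  end.

Section Ip.
Variables (bp : BinProducts C) (lcc : LCCStructure C).

Definition sl (X : C) (F : Hom X (U p)) : Slice (U p) := {| sob := X; sarr := F |}.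

(* (U x Y, pr1) and Id_U x f, in the slice over U. *)
Definition slU (Y : C) : Slice (U p) := sl (pr1 (bp (U p) Y)).

Lemma slU_subproof (Y Y' : C) (f : Hom Y Y') :
  prod_map bp (idc (U p)) f >> pr1 (bp (U p) Y') = pr1 (bp (U p) Y).
Proof. by rewrite /prod_map pair1 compf1. Qed.

Definition slU_map (Y Y' : C) (f : Hom Y Y') : Hom (slU Y) (slU Y') :=
  Build_SliceHom (A := slU Y) (B := slU Y') (slU_subproof f).

Definition Ip_sl (Y : C) : Slice (U p) :=
  ihom (lcc_hom lcc (U p)) (sl (up p)) (slU Y).

Definition prI (Y : C) : Hom (sob (Ip_sl Y)) (U p) := sarr (Ip_sl Y).

Program Definition Ip : Functor C C := {|
  fob := fun Y => sob (Ip_sl Y);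
  fmap := fun Y Y' f => shom (ihom_map (lcc_hom lcc (U p)) (sl (up p)) (slU_map f))
|}.
Next Obligation.
move=> Y /=; rewrite (_ : slU_map (idc Y) = idc (slU Y)) ?ihom_map_id //.
by apply: SliceHom_eq; rewrite /= prod_map_id.
Qed.
Next Obligation.
move=> X Y Z f g /=.
rewrite (_ : slU_map (f >> g) = slU_map f >> slU_map g) ?ihom_map_comp //.
by apply: SliceHom_eq; rewrite /= -prod_map_comp comp1f.
Qed.

Fixpoint Ipn (n : nat) : Functor C C :=
  match n with
  | 0 => functor_id C
  | S m => functor_comp (Ipn m) Ip
  end.

(* The product (X,F) x_U (Ut,p) in the slice over U. *)
Definition fib (X : C) (F : Hom X (U p)) : BinProduct (sl F) (sl (up p)) :=
  lcc_prod lcc (U p) (sl F) (sl (up p)).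

Definition evI (Y : C) : Hom (sob (prod_ob (fib (prI Y)))) (prod_ob (bp (U p) Y)) :=
  shom (ev (lcc_hom lcc (U p)) (sl (up p)) (slU Y)).

Section Iota.
Variables (X : C) (F : Hom X (U p)).

Definition pF_sl : Hom (sl (pF F >> F)) (sl F) :=
  Build_SliceHom (A := sl (pF F >> F)) (B := sl F) (shom := pF F) eq_refl.

Definition QF_sl : Hom (sl (pF F >> F)) (sl (up p)) :=
  Build_SliceHom (A := sl (pF F >> F)) (B := sl (up p)) (shom := QF F)
    (eq_sym (pb_comm (upb p F))).

Definition iota_sl : Hom (sl (pF F >> F)) (prod_ob (fib F)) :=
  pair (fib F) pF_sl QF_sl.

Definition iota : Hom (ext F) (sob (prod_ob (fib F))) := shom iota_sl.

Lemma iota1 : iota >> shom (pr1 (fib F)) = pF F.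
Proof. exact: (f_equal (@shom _ _ _ _) (pair1 (fib F) pF_sl QF_sl)). Qed.

Lemma iota2 : iota >> shom (pr2 (fib F)) = QF F.
Proof. exact: (f_equal (@shom _ _ _ _) (pair2 (fib F) pF_sl QF_sl)). Qed.

Lemma iota_inv_subproof :
  shom (pr1 (fib F)) >> F = shom (pr2 (fib F)) >> up p.
Proof. by rewrite (shom_over (pr1 (fib F))) (shom_over (pr2 (fib F))). Qed.

Definition iota_inv : Hom (sob (prod_ob (fib F))) (ext F) :=
  pb_lift (upb p F) iota_inv_subproof.

Lemma iota_inv1 : iota_inv >> pF F = shom (pr1 (fib F)).
Proof. exact: pb_lift1. Qed.

Lemma iota_inv2 : iota_inv >> QF F = shom (pr2 (fib F)).
Proof. exact: pb_lift2. Qed.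

Lemma fib_uniq (W : C) (h h' : Hom W (sob (prod_ob (fib F)))) :
  h >> shom (pr1 (fib F)) = h' >> shom (pr1 (fib F)) ->
  h >> shom (pr2 (fib F)) = h' >> shom (pr2 (fib F)) -> h = h'.
Proof.
move=> e1 e2.
have eh' : h' >> sarr (prod_ob (fib F)) = h >> sarr (prod_ob (fib F)).
  by rewrite -(shom_over (pr1 (fib F))) !compA e1.
pose A : Slice (U p) := sl (h >> sarr (prod_ob (fib F))).
pose k : Hom A (prod_ob (fib F)) := Build_SliceHom (A := A) (shom := h) eq_refl.
pose k' : Hom A (prod_ob (fib F)) := Build_SliceHom (A := A) (shom := h') eh'.
suff : k = k' by move/(f_equal (@shom _ _ _ _)).
by apply: (@pair_uniq _ _ _ (fib F)); apply: SliceHom_eq.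
Qed.

Lemma iotaK : iota >> iota_inv = idc _.
Proof.
by apply: ext_uniq; rewrite -compA ?iota_inv1 ?iota_inv2 ?iota1 ?iota2 comp1f.
Qed.

Lemma iota_invK : iota_inv >> iota = idc _.
Proof.
by apply: fib_uniq; rewrite -compA ?iota1 ?iota2 ?iota_inv1 ?iota_inv2 comp1f.
Qed.

End Iota.

Definition st (Y : C) : Hom (ext (prI Y)) Y :=
  iota (prI Y) >> evI Y >> pr2 (bp (U p) Y).

(* The family g |-> (g >> prI Y, Q g (prI Y) >> st Y), of which eta is the
   inverse. *)
Program Definition etaInv (Y : C) : PshMor (Yo (Ip Y)) (Dp (Yo Y)) := {|
  pmor := fun X (g : Hom X (Ip Y)) =>
    existT _ (g >> prI Y) (Q g (prI Y) >> st Y)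
|}.
Next Obligation.
move=> Y X' X f g.
exact: (@act_comp _ (Dp (Yo Y)) _ _ _ f g (existT _ (prI Y) (st Y))).
Qed.

Section EtaBij.
Variables (Y X : C).

Definition uncurryI (F : Hom X (U p)) (v : Hom (sl F) (Ip_sl Y)) :
    Hom (prod_ob (fib F)) (slU Y) :=
  prod_map (lcc_prod lcc (U p)) v (idc (sl (up p)))
    >> ev (lcc_hom lcc (U p)) (sl (up p)) (slU Y).

Lemma etaInv_sl (F : Hom X (U p)) (v : Hom (sl F) (Ip_sl Y)) :
  etaInv Y X (shom v) =
  existT (fun F => Hom (ext F) Y) F
    (iota F >> shom (uncurryI v) >> pr2 (bp (U p) Y)).
Proof.
rewrite /etaInv /= /uncurryI /st !compA.
case: v => /= g e; destruct e => /=.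
pose v := Build_SliceHom (A := sl (g >> prI Y)) (B := Ip_sl Y) (shom := g) eq_refl.
apply: (f_equal (existT _ _)); congr (_ >> _ >> _).
change (Q g (prI Y) >> iota (prI Y) =
  iota (g >> prI Y)
    >> shom (prod_map (lcc_prod lcc (U p)) v (idc (sl (up p))))).
apply: fib_uniq; rewrite -!compA.
  rewrite iota1 Q_pF.
  have := f_equal (@shom _ _ _ _) (pair1 (fib (prI Y)) (pr1 (fib (g >> prI Y)) >> v)
            (pr2 (fib (g >> prI Y)) >> idc (sl (up p)))).
  by move=> /= ->; rewrite compA iota1.
rewrite iota2 Q_QF.
have := f_equal (@shom _ _ _ _) (pair2 (fib (prI Y)) (pr1 (fib (g >> prI Y)) >> v)
          (pr2 (fib (g >> prI Y)) >> idc (sl (up p)))).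
by move=> /= ->; rewrite compf1 iota2.
Qed.

Lemma uncurryI_over (F : Hom X (U p)) (y : Hom (ext F) Y) :
  pair (bp (U p) Y) (shom (pr1 (fib F)) >> F) (iota_inv F >> y)
    >> sarr (slU Y) = sarr (prod_ob (fib F)).
Proof. by rewrite /= pair1 (shom_over (pr1 (fib F))). Qed.

Definition etaFun (x : Dp (Yo Y) X) : Hom (sl (projT1 x)) (Ip_sl Y) :=
  binv (ihom_bij (lcc_hom lcc (U p)) (sl (projT1 x)) (sl (up p)) (slU Y))
    (Build_SliceHom (A := prod_ob (fib (projT1 x))) (B := slU Y)
       (uncurryI_over (projT2 x))).

Lemma etaFun_uncurry (x : Dp (Yo Y) X) :
  shom (uncurryI (etaFun x)) =
  pair (bp (U p) Y) (shom (pr1 (fib (projT1 x))) >> projT1 x)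
    (iota_inv (projT1 x) >> projT2 x).
Proof.
exact: (f_equal (@shom _ _ _ _)
  (binvK (ihom_bij (lcc_hom lcc (U p)) (sl (projT1 x)) (sl (up p)) (slU Y)) _)).
Qed.

Lemma etaInvK (x : Dp (Yo Y) X) : etaInv Y X (shom (etaFun x)) = x.
Proof.
rewrite etaInv_sl etaFun_uncurry -compA pair2 compA iotaK comp1f.
by case: x.
Qed.

Lemma etaFunK (g : Hom X (Ip Y)) : shom (etaFun (etaInv Y X g)) = g.
Proof.
pose v := Build_SliceHom (A := sl (g >> prI Y)) (B := Ip_sl Y) (shom := g) eq_refl.
suff -> : etaFun (etaInv Y X g) = v by [].
apply: ihom_inj; apply: SliceHom_eq.
have e := inj_pair2 _ _ _ _ _ (etaInv_sl v).
rewrite (etaFun_uncurry (etaInv Y X g)) /=.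
apply: (@pair_uniq _ _ _ (bp (U p) Y)).
  rewrite pair1 (shom_over (uncurryI v)).
  exact: (shom_over (pr1 (fib (g >> prI Y)))).
by rewrite pair2 e /= !compA iota_invK comp1f.
Qed.

Definition etaInv_bij : Bij (etaInv Y X) :=
  @Build_Bij _ (Dp (Yo Y) X) (etaInv Y X) (fun x => shom (etaFun x)) etaFunK etaInvK.

End EtaBij.

Definition eta (Y : C) : PshMor (Dp (Yo Y)) (Yo (Ip Y)) :=
  psh_inv (etaInv_bij Y).

Fixpoint etan (n : nat) (Y : C) : PshMor (Dpn n (Yo Y)) (Yo (Ipn n Y)) :=
  match n with
  | 0 => psh_id (Yo Y)
  | S m => Dp_map (etan m Y) >>> eta (Ipn m Y)
  end.

End Ip.

Section CSystem.
Variable ptC : FinalObject C.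

(* The set Ob_n(C,p) and the function int on it, defined together since each
   is used in the recursion for the other. *)
Fixpoint ObInt (n : nat) : {A : Type & A -> C} :=
  match n with
  | 0 => existT (fun A : Type => A -> C) unit (fun _ => pt ptC)
  | S m => existT (fun A : Type => A -> C)
               {A : projT1 (ObInt m) & Hom (projT2 (ObInt m) A) (U p)}
               (fun B => ext (projT2 B))
  end.

Definition Obn (n : nat) : Type := projT1 (ObInt n).
Definition intn (n : nat) : Obn n -> C := projT2 (ObInt n).

(* With primitive projections, ft (star f) is convertible to the domain of f
   when T is of the form CcOb (S n) B. *)
#[local] Set Primitive Projections.
Record ccOb := CcOb { l : nat; ob : Obn l }.
Arguments CcOb : clear implicits.
#[local] Unset Primitive Projections.

Definition obA (n : nat) (B : Obn (S n)) : Obn n := projT1 B.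
Definition obF (n : nat) (B : Obn (S n)) : Hom (intn (obA B)) (U p) := projT2 B.

Definition int_ob (G : ccOb) : C := intn (ob G).

Program Definition CC : Category := {|
  Obj := ccOb;
  Hom := fun G' G => Hom (int_ob G') (int_ob G);
  idc := fun G => idc (int_ob G);
  comp := fun _ _ _ f g => f >> g
|}.
Next Obligation. by move=> *; exact: comp1f. Qed.
Next Obligation. by move=> *; exact: compf1. Qed.
Next Obligation. by move=> *; exact: compA. Qed.

Program Definition int : Functor CC C := {|
  fob := int_ob;
  fmap := fun G' G (f : Hom (int_ob G') (int_ob G)) => f
|}.

Definition ccExt (G : CC) (F : Hom (int G) (U p)) : CC :=
  CcOb (S (l G)) (existT _ (ob G) F).

Definition ft (T : CC) : CC :=
  match T with CcOb n B =>
    match n return Obn n -> CC with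
    | 0 => fun _ => CcOb 0 tt
    | S m => fun B => CcOb m (obA B)
    end B
  end.

Definition pT (T : CC) : @Hom CC T (ft T) :=
  match T as T return @Hom CC T (ft T) with CcOb n B =>
    match n return forall B : Obn n, @Hom CC (CcOb _ B) (ft (CcOb _ B)) with
    | 0 => fun _ => idc (pt ptC)
    | S m => fun B => pF (obF B)
    end B
  end.

(* f^*(T) and q(f,T); meant for l(T) > 0, with harmless values otherwise. *)
Definition star (G : CC) (T : CC) : @Hom CC G (ft T) -> CC :=
  match T as T return @Hom CC G (ft T) -> CC with CcOb n B =>
    match n return forall B : Obn n, @Hom CC G (ft (CcOb _ B)) -> CC with
    | 0 => fun _ _ => G
    | S m => fun B f => ccExt (G := G) (fmap int f >> obF B)
    end B
  end.

Definition q (G : CC) (T : CC) :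
    forall f : @Hom CC G (ft T), @Hom CC (star f) T :=
  match T as T return forall f : @Hom CC G (ft T), @Hom CC (star f) T with CcOb n B =>
    match n return forall (B : Obn n) (f : @Hom CC G (ft (CcOb _ B))),
                     @Hom CC (star f) (CcOb _ B) with
    | 0 => fun _ f => f
    | S m => fun B f => Q (fmap int f) (obF B)
    end B
  end.

Fixpoint ftn (n : nat) (T : CC) : CC :=
  match n with
  | 0 => T
  | S m => ftn m (ft T)
  end.

Lemma l_ft (T : CC) : l (ft T) = l T - 1.
Proof. by case: T => -[|k] B //=; lia. Qed.

(* f^*(T), with q(f,T) : f^*(T) -> T, for f : G' -> G and ft^n(T) = G. *)
Fixpoint pull (n : nat) (G G' : CC) (f : Hom G' G) :
    forall T : CC, ftn n T = G -> SliceOb T :=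
  match n return forall T : CC, ftn n T = G -> SliceOb T with
  | 0 => fun T e =>
      {| sob := G'; sarr := eq_rect G (fun T => Hom G' T) f T (eq_sym e) |}
  | S m => fun T e =>
      let r := pull f (T := ft T) e in
      {| sob := star (sarr r); sarr := q (sarr r) |}
  end.

Lemma ccExt_eq (G G0 : CC) (F F' : Hom (int G) (U p)) (F0 : Hom (int G0) (U p))
    (a : Hom (int G) (int G0)) (h : Hom (ext F) (ext F0)) (h' : Hom (ext F') (ext F0)) :
  F = F' ->
  h >> pF F0 = pF F >> a -> h' >> pF F0 = pF F' >> a ->
  h >> QF F0 = QF F -> h' >> QF F0 = QF F' ->
  Build_SliceOb (C := CC) (Z := ccExt F0) (sob := ccExt F) h =
  Build_SliceOb (C := CC) (Z := ccExt F0) (sob := ccExt F') h'.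
Proof.
move=> e; subst F' => e1 e2 e3 e4.
by rewrite (_ : h = h') //; apply: ext_uniq; rewrite ?e1 ?e2 ?e3 ?e4.
Qed.

Lemma star_id (T : CC) :
  Build_SliceOb (q (idc (ft T))) = Build_SliceOb (idc T).
Proof.
case: T => -[|n]; first by case.
case=> A F; apply: (@ccExt_eq (CcOb n A) (CcOb n A) _ _ F (idc (intn A))).
- exact: comp1f.
- exact: Q_pF.
- by rewrite comp1f compf1.
- exact: Q_QF.
- exact: comp1f.
Qed.

Lemma star_comp (T R R' : CC) (f : @Hom CC R (ft T)) (g : @Hom CC R' R)
    (g' : @Hom CC R' (ft (star f))) (e : R = ft (star f)) :
  0 < l T -> g' = g >> idto e ->
  Build_SliceOb (q (g >> f)) = Build_SliceOb (q g' >> q f).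
Proof.
case: T f g g' e => -[|n]; first by move=> B f g g' e /Nat.nlt_0_r.
case=> A F f g g' /= e _; rewrite (proof_irrelevance _ e eq_refl) {e} /=.
rewrite /idto /= compf1 => eg; subst g'.
apply: (@ccExt_eq R' (CcOb n A) _ _ F (@comp C _ _ _ g f)).
- by rewrite /obF /= -compA.
- exact: Q_pF.
- exact: Q2_pF.
- exact: Q_QF.
- exact: Q2_QF.
Qed.

Lemma pull_id (n : nat) (G T : CC) (e : ftn n T = G) :
  pull (idc G) e = Build_SliceOb (idc T).
Proof.
elim: n T e => [|n IH] T e /=; first by subst G.
by rewrite IH /= star_id.
Qed.

Definition inOb (n : nat) (G T : CC) : Prop := l T = l G + n /\ ftn n T = G.

Lemma pull_mem (n : nat) (G G' : CC) (f : Hom G' G) (T : CC) (e : ftn n T = G) :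
  l T = l G + n -> inOb n G' (sob (pull f e)).
Proof.
elim: n T e => [|n IH] T e hl; first by split=> //=; lia.
case: T e hl => -[|k] B e hl; first by move: hl => /=; lia.
have hl' : l (ft (CcOb (S k) B)) = l G + n by move: hl => /=; lia.
by have [h1 h2] := IH _ e hl'; split=> //=; rewrite h1; lia.
Qed.

Lemma pull_comp (n : nat) (G G' G'' : CC) (g : Hom G'' G') (f : Hom G' G)
    (T : CC) (e : ftn n T = G) (e' : ftn n (sob (pull f e)) = G') :
  l T = l G + n ->
  pull (g >> f) e = Build_SliceOb (sarr (pull g e') >> sarr (pull f e)).
Proof.
elim: n T e e' => [|n IH] T e e' hl.
  by subst G; rewrite /= (proof_irrelevance _ e' eq_refl).
case: T e e' hl => -[|k] B e e' hl; first by move: hl => /=; lia.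
have hl' : l (ft (CcOb (S k) B)) = l G + n by move: hl => /=; lia.
have /= E := IH (ft (CcOb (S k) B)) e e' hl'.
rewrite /= E /=.
apply: (star_comp (e := eq_refl)) => /=; first by lia.
by rewrite /idto /= compf1.
Qed.

Definition Ob (n : nat) (G : CC) : Type := {T : CC | inOb n G T}.

Lemma Ob_eq (n : nat) (G : CC) (T T' : Ob n G) :
  proj1_sig T = proj1_sig T' -> T = T'.
Proof.
case: T T' => [T h] [T' h'] /= e; subst T'.
by rewrite (proof_irrelevance _ h h').
Qed.

Program Definition ObP (n : nat) : Presheaf CC := {|
  psh := Ob n;
  act := fun G' G f T =>
    exist _ (sob (pull f (proj2 (proj2_sig T))))
            (pull_mem f (proj2 (proj2_sig T)) (proj1 (proj2_sig T)))
|}.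
Next Obligation. by move=> n G T; apply: Ob_eq; rewrite /= pull_id. Qed.
Next Obligation.
move=> n G'' G' G g f T; apply: Ob_eq => /=.
by rewrite (pull_comp _ (proj2 (pull_mem f _ (proj1 (proj2_sig T)))) (proj1 (proj2_sig T))).
Qed.

Lemma pullSec_subproof (X' X : C) (f : Hom X' X) (F : Hom X (U p)) (s : sec (pF F)) :
  idc X' >> (f >> F) = (f >> proj1_sig s >> QF F) >> up p.
Proof.
rewrite comp1f -compA -(pb_comm (upb p F)) -/(pF F) -!compA; congr (_ >> _).
by rewrite compA (proj2_sig s) comp1f.
Qed.

Definition pullSec (X' X : C) (f : Hom X' X) (F : Hom X (U p)) (s : sec (pF F)) :
    sec (pF (f >> F)) :=
  exist _ (pb_lift (upb p (f >> F)) (pullSec_subproof f s)) (pb_lift1 _ _).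

Lemma pullSec_QF (X' X : C) (f : Hom X' X) (F : Hom X (U p)) (s : sec (pF F)) :
  proj1_sig (pullSec f s) >> QF (f >> F) = f >> proj1_sig s >> QF F.
Proof. exact: pb_lift2. Qed.

Lemma pullSec_Q (X' X : C) (f : Hom X' X) (F : Hom X (U p)) (s : sec (pF F)) :
  proj1_sig (pullSec f s) >> Q f F = f >> proj1_sig s.
Proof.
have e := pullSec_QF f s; have e1 := proj2_sig (pullSec f s); move: e e1.
move: (proj1_sig (pullSec f s)) => t e e1; apply: ext_uniq.
  by rewrite -!compA Q_pF (proj2_sig s) compf1 compA e1 comp1f.
by rewrite -compA Q_QF.
Qed.

Lemma pullSec2_QF (X'' X' X : C) (g : Hom X'' X') (f : Hom X' X)
    (F : Hom X (U p)) (s : sec (pF F)) :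
  proj1_sig (pullSec (g >> f) s) >> QF ((g >> f) >> F) =
  proj1_sig (pullSec g (pullSec f s)) >> QF (g >> (f >> F)).
Proof. by rewrite pullSec_QF pullSec_QF -(compA g _ (QF _)) pullSec_QF !compA. Qed.

(* f^*(o), for f : G -> ft(T) and o a section of p_T. *)
Definition starSec (T G : CC) : forall f : @Hom CC G (ft T), 
    0 < l T -> sec (pT T) -> sec (pT (star f)) :=
  match T as T return forall f : @Hom CC G (ft T),
      0 < l T -> sec (pT T) -> sec (pT (star f)) with CcOb n B =>
    match n return forall (B : Obn n) (f : @Hom CC G (ft (CcOb n B))),
        0 < n -> sec (pT (CcOb n B)) -> sec (pT (star f)) with
    | 0 => fun _ _ h _ => False_rect _ (Nat.nlt_0_r _ h)
    | S m => fun B f _ s => pullSec (fmap int f) (F := obF B) s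
    end B
  end.

Lemma ft_star (T G : CC) (f : @Hom CC G (ft T)) : 0 < l T -> ft (star f) = G.
Proof. by case: T f => -[|k] B f //= h; case: (Nat.nlt_0_r _ h). Qed.

Lemma sec_eq (D : Category) (X Y : D) (r : Hom Y X) (s s' : sec r) :
  proj1_sig s = proj1_sig s' -> s = s'.
Proof.
case: s s' => [s e] [s' e'] /= es; subst s'.
by rewrite (proof_irrelevance _ e e').
Qed.

(* starSec f h o is the unique section s of p_{f^*(T)} with
   s >> q(f,T) = f >> o; idto only identifies ft(f^*(T)) with the domain of f. *)
Lemma starSec_spec (T G : CC) (f : @Hom CC G (ft T)) (h : 0 < l T) (o : sec (pT T)) :
  proj1_sig (starSec f h o) >> q f = idto (ft_star f h) >> f >> proj1_sig o.
Proof.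
move: (ft_star f h); case: T f h o => -[|k] B f h o; first by case: (Nat.nlt_0_r _ h).
move=> e; rewrite (proof_irrelevance _ e eq_refl) {e} /idto [eq_rect _ _ _ _ _]/= comp1f.
exact: (pullSec_Q (fmap int f) (F := obF B) o).
Qed.

Lemma starSec_uniq (T G : CC) (f : @Hom CC G (ft T)) (s s' : sec (pT (star f))) :
  0 < l T -> proj1_sig s >> q f = proj1_sig s' >> q f -> s = s'.
Proof.
case: T f s s' => -[|k] B f s s' h; first by case: (Nat.nlt_0_r _ h).
move=> e; apply: sec_eq; apply: (@ext_uniq _ _ (fmap int f >> obF B)).
  exact: (eq_trans (proj2_sig s) (eq_sym (proj2_sig s'))).
rewrite -Q_QF !(@compA C).
exact: (f_equal (fun h => @comp C _ _ _ h (QF (obF B))) e).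
Qed.

Definition rawSec : Type := {T : CC & sec (pT T)}.

Definition rawStar (T : CC) (h : 0 < l T) (o : sec (pT T)) (r : SliceOb (ft T)) : rawSec :=
  existT (fun T : CC => sec (pT T)) (star (sarr r)) (starSec (sarr r) h o).

Lemma rawSec_eq (G : CC) (F F' : Hom (int G) (U p)) (s : sec (pF F)) (s' : sec (pF F')) :
  F = F' -> proj1_sig s >> QF F = proj1_sig s' >> QF F' ->
  existT (fun T : CC => sec (pT T)) (ccExt F) s =
  existT (fun T : CC => sec (pT T)) (ccExt F') s'.
Proof.
move=> e; subst F' => e; rewrite (_ : s = s') //; apply: sec_eq.
by apply: ext_uniq => //; rewrite (proj2_sig s) (proj2_sig s').
Qed.

Lemma rawStar_id (T : CC) (h : 0 < l T) (o : sec (pT T)) :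
  rawStar h o (Build_SliceOb (idc (ft T))) = existT _ T o.
Proof.
case: T h o => -[|n] B h o; first by case: (Nat.nlt_0_r _ h).
case: B h o => A F h o.
apply: (@rawSec_eq (CcOb n A) _ F); first exact: comp1f.
rewrite -(comp1f (X := int (CcOb n A)) (proj1_sig o)); exact: pullSec_QF.
Qed.

Lemma rawStar_comp (T R R' : CC) (f : @Hom CC R (ft T)) (g : @Hom CC R' R)
    (g' : @Hom CC R' (ft (star f))) (e : R = ft (star f))
    (h : 0 < l T) (h' : 0 < l (star f)) (o : sec (pT T)) :
  g' = g >> idto e ->
  rawStar h o (Build_SliceOb (g >> f)) =
  rawStar h' (starSec f h o) (Build_SliceOb g').
Proof.
case: T f g g' e h h' o => -[|n].
  by move=> B f g g' e h; case: (Nat.nlt_0_r _ h).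
case=> A F f g g' /= e h h' o; rewrite (proof_irrelevance _ e eq_refl) {e} /=.
rewrite /idto /= compf1 => eg; subst g'.
apply: (@rawSec_eq R').
  by rewrite /obF /= -compA.
exact: (pullSec2_QF (fmap int g) (fmap int f) (F := F) o).
Qed.

(* Here n starts at 0: tOb n consists of the sections o of p_T for T = bd o in
   Ob (S n), so it is the presheaf usually written with a tilde and index
   n + 1. *)
Definition tOb (n : nat) (G : CC) : Type :=
  {T : Ob (S n) G & sec (pT (proj1_sig T))}.

Definition traw (n : nat) (G : CC) (x : tOb n G) : rawSec :=
  existT (fun T : CC => sec (pT T)) (proj1_sig (projT1 x)) (projT2 x).

Lemma tOb_eq (n : nat) (G : CC) (x y : tOb n G) : traw x = traw y -> x = y.
Proof.
case: x y => [[T h] o] [[T' h'] o']; rewrite /traw /= => e.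
have e' : T = T' := f_equal (@projT1 _ _) e; subst T'.
rewrite (inj_pair2 _ _ _ _ _ e).
by rewrite (proof_irrelevance _ h h').
Qed.

Lemma Ob_pos (n : nat) (G : CC) (T : Ob (S n) G) : 0 < l (proj1_sig T).
Proof. by case: T => T [/= h _]; lia. Qed.

Program Definition tObP (n : nat) : Presheaf CC := {|
  psh := tOb n;
  act := fun G' G f x =>
    existT (fun T : Ob (S n) G' => sec (pT (proj1_sig T)))
      (act (ObP (S n)) f (projT1 x))
      (starSec (sarr (pull (n := n) f (T := ft (proj1_sig (projT1 x)))
                        (proj2 (proj2_sig (projT1 x)))))
         (Ob_pos (projT1 x)) (projT2 x))
|}.
Next Obligation.
move=> n G [[T h] o]; apply: tOb_eq.
transitivity (rawStar (Ob_pos (exist _ T h)) o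
                (pull (n := n) (idc G) (T := ft T) (proj2 h))) => //.
by rewrite pull_id rawStar_id.
Qed.
Next Obligation.
move=> n G'' G' G g f [[T h] o]; apply: tOb_eq.
case: T h o => -[|k] B h o; first by have [h0 _] := h; move: h0 => /=; lia.
set T := CcOb (S k) B in h o *.
have hl : l (ft T) = l G + n by have [h0 _] := h; rewrite l_ft; lia.
pose r := pull (n := n) f (T := ft T) (proj2 h).
have [_ e] := pull_mem (n := n) f (T := ft T) (proj2 h) hl.
transitivity (rawStar (Ob_pos (exist _ T h)) o
                (pull (n := n) (g >> f) (T := ft T) (proj2 h))) => //.
rewrite (pull_comp g e hl).
have h' : 0 < l (star (sarr r)) by rewrite /=; lia.
apply: (eq_trans (@rawStar_comp T (sob r) _ (sarr r) (sarr (pull g e))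
  (sarr (pull g e)) eq_refl _ h' o _)); first by rewrite /idto /= compf1.
by rewrite /traw /= (proof_irrelevance _ (proj2 (pull_mem f (proj2 h) (proj1 h))) e).
Qed.

Program Definition bd (n : nat) : PshMor (tObP n) (ObP (S n)) :=
  {| pmor := fun G x => projT1 x |}.

Definition lastF (T : CC) : 0 < l T -> Hom (int (ft T)) (U p) :=
  match T as T return 0 < l T -> Hom (int (ft T)) (U p) with CcOb n B =>
    match n return forall B : Obn n, 0 < n -> Hom (int (ft (CcOb n B))) (U p) with
    | 0 => fun _ h => False_rect _ (Nat.nlt_0_r _ h)
    | S m => fun B _ => obF B
    end B
  end.

Definition u1 (G : CC) (T : Ob 1 G) : Hom (int G) (U p) :=
  eq_rect _ (fun G : CC => Hom (int G) (U p)) (lastF (Ob_pos T)) G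
    (proj2 (proj2_sig T)).

Lemma int_u1 (G : CC) (T : Ob 1 G) : int (proj1_sig T) = ext (u1 T).
Proof.
case: T => T hT; rewrite /u1; move: (Ob_pos _) (proj2 _) => /=.
case: T {hT} => -[|k] B h e; first by case: (Nat.nlt_0_r _ h).
by subst G.
Qed.

Lemma l_ftn (n : nat) (T : CC) : l (ftn n T) = l T - n.
Proof. by elim: n T => [|n IH] T /=; rewrite ?IH ?l_ft; lia. Qed.

Lemma ft_ftn (n : nat) (T : CC) : ft (ftn n T) = ftn n (ft T).
Proof. by elim: n T => [|n IH] T //=. Qed.

(* ft^n(T), as an element of Ob_1(G), for T in Ob_{n+1}(G). *)
Lemma ftOb_subproof (n : nat) (G : CC) (T : Ob (S n) G) :
  inOb 1 G (ftn n (proj1_sig T)).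
Proof. by case: T => T [h e]; split; rewrite /= ?l_ftn ?ft_ftn //; lia. Qed.

Definition ftOb (n : nat) (G : CC) (T : Ob (S n) G) : Ob 1 G :=
  exist _ (ftn n (proj1_sig T)) (ftOb_subproof T).

(* T, as an element of Ob_n(ft^n(T)), for T in Ob_{n+1}(G). *)
Lemma overOb_subproof (n : nat) (G : CC) (T : Ob (S n) G) :
  inOb n (ftn n (proj1_sig T)) (proj1_sig T).
Proof. by case: T => T [h e]; split; rewrite /= ?l_ftn //; lia. Qed.

Definition overOb (n : nat) (G : CC) (T : Ob (S n) G) :
    Ob n (ftn n (proj1_sig T)) :=
  exist _ (proj1_sig T) (overOb_subproof T).

(* u_fun n and tu_fun n are u_{n+1} and its analogue for sections.  The second
   component lives over int (ft^m(T)), which equals (int(G); u_1(ft^m(T))) by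
   int_u1 only propositionally; hence the casts. *)
Fixpoint u_fun (n : nat) : forall G : CC, Ob (S n) G -> Dpn n (Yo (U p)) (int G) :=
  match n return forall G : CC, Ob (S n) G -> Dpn n (Yo (U p)) (int G) with
  | 0 => fun G T => u1 T
  | S k => fun G T =>
      existT (fun F => Dpn k (Yo (U p)) (ext F))
        (u1 (ftOb T))
        (eq_rect _ (Dpn k (Yo (U p))) (u_fun (overOb T)) _ (int_u1 (ftOb T)))
  end.

Definition tu1 (G : CC) (o : tOb 0 G) : Hom (int G) (Ut p) :=
  let T := projT1 o in
  idto (f_equal int (eq_sym (proj2 (proj2_sig T))))
    >> fmap int (proj1_sig (projT2 o))
    >> idto (int_u1 T) >> QF (u1 T).

Definition overtOb (n : nat) (G : CC) (o : tOb (S n) G) :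
    tOb n (ftn (S n) (proj1_sig (projT1 o))) :=
  existT _ (overOb (projT1 o)) (projT2 o).

Fixpoint tu_fun (n : nat) : forall G : CC, tOb n G -> Dpn n (Yo (Ut p)) (int G) :=
  match n return forall G : CC, tOb n G -> Dpn n (Yo (Ut p)) (int G) with
  | 0 => fun G o => tu1 o
  | S k => fun G o =>
      let T := projT1 o in
      existT (fun F => Dpn k (Yo (Ut p)) (ext F))
        (u1 (ftOb T))
        (eq_rect _ (Dpn k (Yo (Ut p))) (tu_fun (overtOb o)) _ (int_u1 (ftOb T)))
  end.

Lemma Ob1_ext (G T : CC) :
  inOb 1 G T -> exists F : Hom (int G) (U p), T = ccExt F.
Proof.
case: T => -[|k] B [h /= e]; first by move: h => /=; lia.
by subst G; case: B h => A F h; exists F.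
Qed.

Lemma u1_ext (G : CC) (F : Hom (int G) (U p)) (h : inOb 1 G (ccExt F)) :
  u1 (exist _ (ccExt F) h) = F.
Proof.
by rewrite /u1 (proof_irrelevance _ (proj2 _) eq_refl) /=.
Qed.

(* Base change along f of an object over ccExt F factors through Q f F. *)
Lemma pull_split (n : nat) (G G' : CC) (f : Hom G' G) (F : Hom (int G) (U p))
    (T : CC) (e : ftn (S n) T = G) (e1 : ftn n T = ccExt F) :
  pull f e =
  pull (G := ccExt F) (G' := ccExt (G := G') (fmap int f >> F))
    (Q (fmap int f) F) e1.
Proof.
elim: n T e e1 => [|n IH] T e e1.
  have E : T = ccExt F := e1.
  move: e e1; rewrite {}E => /= e e1.
  by rewrite (proof_irrelevance _ e eq_refl) (proof_irrelevance _ e1 eq_refl).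
pose step (r : SliceOb (ft T)) : SliceOb T :=
  {| sob := star (sarr r); sarr := q (sarr r) |}.
exact: (f_equal step (IH (ft T) e e1)).
Qed.

Lemma u1_pair (P : C -> Type) (G T1 : CC) (h : inOb 1 G T1)
    (F : Hom (int G) (U p)) (e : T1 = ccExt F) (x : P (int T1)) :
  existT (fun F => P (ext F)) (u1 (exist _ T1 h))
    (eq_rect _ P x _ (int_u1 (exist _ T1 h))) =
  existT (fun F => P (ext F)) F (eq_rect T1 (fun T => P (int T)) x (ccExt F) e).
Proof.
subst T1; move: (int_u1 _) => /=; rewrite u1_ext => e.
by rewrite (proof_irrelevance _ e eq_refl).
Qed.

Lemma u_fun_cast (n : nat) (T1 T2 : CC) (e : T1 = T2) (T : Ob (S n) T1)
    (T' : Ob (S n) T2) :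
  proj1_sig T = proj1_sig T' ->
  eq_rect T1 (fun G : CC => Dpn n (Yo (U p)) (int G)) (u_fun T) T2 e = u_fun T'.
Proof. by subst T2; move=> eT; rewrite (Ob_eq eT). Qed.

Lemma tu_fun_cast (n : nat) (T1 T2 : CC) (e : T1 = T2) (o : tOb n T1) (o' : tOb n T2) :
  traw o = traw o' ->
  eq_rect T1 (fun G : CC => Dpn n (Yo (Ut p)) (int G)) (tu_fun o) T2 e = tu_fun o'.
Proof. by subst T2; move=> eo; rewrite (tOb_eq eo). Qed.

Lemma u_fun_S (n : nat) (G : CC) (T : Ob (S (S n)) G) (F : Hom (int G) (U p))
    (T' : Ob (S n) (ccExt F)) :
  ftn (S n) (proj1_sig T) = ccExt F -> proj1_sig T = proj1_sig T' ->
  u_fun T = existT (fun F => Dpn n (Yo (U p)) (ext F)) F (u_fun T').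
Proof.
move=> e eT; rewrite -(@u_fun_cast n _ _ e (overOb T) T' eT).
exact: (u1_pair (P := Dpn n (Yo (U p))) _ e).
Qed.

Lemma tu_fun_S (n : nat) (G : CC) (o : tOb (S n) G) (F : Hom (int G) (U p))
    (o' : tOb n (ccExt F)) :
  ftn (S n) (proj1_sig (projT1 o)) = ccExt F -> traw o = traw o' ->
  tu_fun o = existT (fun F => Dpn n (Yo (Ut p)) (ext F)) F (tu_fun o').
Proof.
move=> e eo; rewrite -(@tu_fun_cast n _ _ e (overtOb o) o' eo).
exact: (u1_pair (P := Dpn n (Yo (Ut p))) _ e).
Qed.

Lemma tu1_ext (G : CC) (F : Hom (int G) (U p)) (h : inOb 1 G (ccExt F))
    (s : sec (pF F)) :
  tu1 (existT (fun T : Ob 1 G => sec (pT (proj1_sig T))) (exist _ (ccExt F) h) s)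
  = proj1_sig s >> QF F.
Proof.
rewrite /tu1 /=; move: (int_u1 _) => /=; rewrite u1_ext => e.
by rewrite (proof_irrelevance _ e eq_refl)
  (proof_irrelevance _ (proj2 h) eq_refl) /idto /= comp1f compf1.
Qed.

Lemma Ob_over (n : nat) (G : CC) (T : Ob (S n) G) :
  exists F : Hom (int G) (U p), ftn n (proj1_sig T) = ccExt F.
Proof. exact: (Ob1_ext (ftOb_subproof T)). Qed.

Definition Ob_at (n : nat) (G T : CC) (F : Hom (int G) (U p)) (h : inOb (S n) G T)
    (e : ftn n T = ccExt F) : inOb n (ccExt F) T.
Proof. by split=> //; have [h1 _] := h; rewrite /=; lia. Defined.

Program Definition u (n : nat) : PshMor (ObP (S n)) (pre int (Dpn n (Yo (U p)))) :=
  {| pmor := fun G => @u_fun n G |}.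
Next Obligation.
elim=> [|n IH] G' G f T.
  case: T => T h; have [F E] := Ob1_ext h; subst T.
  rewrite /u_fun u1_ext /=.
  move: (pull_mem _ _ _) => /=; rewrite (proof_irrelevance _ (proj2 h) eq_refl) /= => h'.
  exact: u1_ext.
have [F e] := Ob_over T; case: T e => T h e.
pose T' : Ob (S n) (ccExt F) := exist _ T (Ob_at h e).
rewrite (@u_fun_S n G _ F T') //.
pose f' : @Hom CC (ccExt (G := G') (fmap int f >> F)) (ccExt F) := Q (fmap int f) F.
have E : pull f (proj2 h) = pull f' (proj2 (Ob_at h e)) by exact: pull_split.
apply: (eq_trans (@u_fun_S n G' _ (fmap int f >> F) (act (ObP (S n)) f' T') _ _)).
- rewrite -/(pull f (proj2 h)).
  have [_ E'] := pull_mem f' (proj2 (Ob_at h e)) (proj1 (Ob_at h e)).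
  by rewrite -E in E'.
- exact: (f_equal (@sob _ _) E).
- exact: (f_equal (existT (fun F => Dpn n (Yo (U p)) (ext F)) _) (IH _ _ f' T')).
Qed.

Program Definition tu (n : nat) : PshMor (tObP n) (pre int (Dpn n (Yo (Ut p)))) :=
  {| pmor := fun G => @tu_fun n G |}.
Next Obligation.
elim=> [|n IH] G' G f o.
  case: o => [[T h] o]; have [F E] := Ob1_ext h; subst T.
  rewrite /tu_fun tu1_ext /=.
  move: (pull_mem _ _ _) => /=; rewrite (proof_irrelevance _ (proj2 h) eq_refl) /= => h'.
  by rewrite tu1_ext pullSec_QF compA.
have [F e] := Ob_over (projT1 o); case: o e => [[T h] o] e.
pose o' : tOb n (ccExt F) := existT _ (exist _ T (Ob_at h e)) o.
rewrite (@tu_fun_S n G _ F o') //.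
pose f' : @Hom CC (ccExt (G := G') (fmap int f >> F)) (ccExt F) := Q (fmap int f) F.
apply: (eq_trans (@tu_fun_S n G' _ (fmap int f >> F) (act (tObP n) f' o') _ _)).
- have E : pull f (proj2 h) = pull f' (proj2 (Ob_at h e)) by exact: pull_split.
  have [_ E'] := pull_mem f' (proj2 (Ob_at h e)) (proj1 (Ob_at h e)).
  by rewrite -E in E'.
- have E : pull (n := S n) f (T := ft T) (proj2 h) =
           pull (n := n) f' (T := ft T) (proj2 (Ob_at h e)) by exact: pull_split.
  transitivity (rawStar (Ob_pos (exist _ T h)) o
                  (pull (n := S n) f (T := ft T) (proj2 h))) => //.
  by rewrite E /traw /rawStar /=; do 2 f_equal; exact: proof_irrelevance.
- exact: (f_equal (existT (fun F => Dpn n (Yo (Ut p)) (ext F)) _) (IH _ _ f' o')).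
Qed.

Definition mu (bp : BinProducts C) (lcc : LCCStructure C) (n : nat) :
    PshMor (ObP (S n)) (pre int (Yo (Ipn bp lcc n (U p)))) :=
  u n >>> pre_map int (etan bp lcc n (U p)).

Definition tmu (bp : BinProducts C) (lcc : LCCStructure C) (n : nat) :
    PshMor (tObP n) (pre int (Yo (Ipn bp lcc n (Ut p)))) :=
  tu n >>> pre_map int (etan bp lcc n (Ut p)).

End CSystem.
End WithUniverse.

(* Main.v *)
From Stdlib Require Import ssreflect Lia ProofIrrelevance FunctionalExtensionality.
Require Import Defs.

(** Both statements reduce to two independent facts, one about objects of the
C-system and one about the locally cartesian closed structure.

An object [T] of length [n + 1] over [G] is an object [ccExt F] of length one
over [G] followed by an object of length [n] over [ccExt F], and a section of
[pT T] is a section over the latter.  Hence [Ob] and [tOb] satisfy, in [n], the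
same recursion as the iterates of [Dp], since [Dp G X] is the set of pairs of
some [F] and an element of [G (ext F)].  At the bottom of the recursion, an
object of length one over [G] is a morphism [int G -> U], and an object with a
section is a morphism [int G -> Ut], because a section of a pullback of [up p]
along [F] is a lift of [F] along [up p].  So [u] and [tu] have explicit pointwise inverses
([u_bij], [tu_bij]), and forgetting the section is composition with [up p] at
the bottom of the recursion ([tu_bd]).

The transformation [eta] is invertible by construction and natural in its
object ([eta_natural]), because currying is natural in the target.  Iterating,
[etan] is an isomorphism ([etan_iso]) carrying the [n]-fold [Dp] of composition
with [f] to composition with the [n]-fold [Ip] of [f] ([etan_natural]).
Composing the two facts gives the theorem. *)

Set Implicit Arguments.
Unset Strict Implicit.
Unset Printing Implicit Defensive.

(** * Isomorphisms of presheaves *)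

Lemma PshMor_eq (C : Category) (P Q : Presheaf C) (r s : PshMor P Q) :
  (forall X x, r X x = s X x) -> r = s.
Proof.
case: r s => r er [s es] /= e.
have e' : r = s.
  by apply: functional_extensionality_dep => X; exact: functional_extensionality.
by subst s; rewrite (proof_irrelevance _ er es).
Qed.

Lemma bij_psh_iso (C : Category) (P Q : Presheaf C) (r : PshMor P Q) :
  (forall X, Bij (r X)) -> is_psh_iso r.
Proof.
move=> b; exists (psh_inv b); split; apply: PshMor_eq => X x /=.
  exact: bijK.
exact: binvK.
Qed.

Lemma psh_inv_iso (C : Category) (P Q : Presheaf C) (r : PshMor P Q)
    (b : forall X, Bij (r X)) :
  is_psh_iso (psh_inv b).
Proof.
exists r; split; apply: PshMor_eq => X x /=.
  exact: binvK.
exact: bijK.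
Qed.

Lemma psh_iso_id (C : Category) (P : Presheaf C) : is_psh_iso (psh_id P).
Proof. by exists (psh_id P); split; apply: PshMor_eq. Qed.

Lemma psh_iso_comp (C : Category) (P Q R : Presheaf C) (r : PshMor P Q)
    (s : PshMor Q R) :
  is_psh_iso r -> is_psh_iso s -> is_psh_iso (r >>> s).
Proof.
case=> r' [er er'] [s' [es es']]; exists (s' >>> r').
split; apply: PshMor_eq => X x /=.
  have /= -> := f_equal (fun t : PshMor Q Q => t X (r X x)) es.
  exact: (f_equal (fun t : PshMor P P => t X x) er).
have /= -> := f_equal (fun t : PshMor Q Q => t X (s' X x)) er'.
exact: (f_equal (fun t : PshMor R R => t X x) es').
Qed.

Lemma pre_map_iso (C D : Category) (Phi : Functor C D) (P Q : Presheaf D)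
    (r : PshMor P Q) :
  is_psh_iso r -> is_psh_iso (pre_map Phi r).
Proof.
case=> s [e e']; exists (pre_map Phi s); split; apply: PshMor_eq => X x /=.
  exact: (f_equal (fun t : PshMor P P => t (Phi X) x) e).
exact: (f_equal (fun t : PshMor Q Q => t (Phi X) x) e').
Qed.

Lemma Dp_map_iso (C : Category) (p : Universe C) (P Q : Presheaf C)
    (r : PshMor P Q) :
  is_psh_iso r -> is_psh_iso (Dp_map p r).
Proof.
case=> s [e e']; exists (Dp_map p s); split; apply: PshMor_eq => X [F x] /=;
  apply: (f_equal (existT _ F)).
  exact: (f_equal (fun t : PshMor P P => t (ext F) x) e).
exact: (f_equal (fun t : PshMor Q Q => t (ext F) x) e').
Qed.

(** * Iterating eta *)

Lemma etan_iso (C : Category) (p : Universe C) (bp : BinProducts C)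
    (lcc : LCCStructure C) (n : nat) (Y : C) :
  is_psh_iso (etan p bp lcc n Y).
Proof.
elim: n => [|n IH]; first exact: psh_iso_id.
by apply: psh_iso_comp; [exact: Dp_map_iso | exact: psh_inv_iso].
Qed.

Fixpoint Dpn_map (C : Category) (p : Universe C) (n : nat) (P Q : Presheaf C)
    (r : PshMor P Q) : PshMor (Dpn p n P) (Dpn p n Q) :=
  match n with
  | 0 => r
  | S m => Dp_map p (Dpn_map p m r)
  end.

Lemma uncurryI_map (C : Category) (p : Universe C) (bp : BinProducts C)
    (lcc : LCCStructure C) (X Y Y' : C) (F : Hom X (U p))
    (v : Hom (sl F) (Ip_sl p bp lcc Y)) (f : Hom Y Y') :
  uncurryI (v >> ihom_map (lcc_hom lcc (U p)) (sl (up p)) (slU_map p bp f)) =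
  uncurryI v >> slU_map p bp f.
Proof.
rewrite /uncurryI -{1}(comp1f (idc (sl (up p)))) prod_map_comp -!compA.
by rewrite ihom_map_ev.
Qed.

(** A morphism [g] to [Ip Y] is, over [U], the currying of a morphism to [U x Y]
from the product over [U] of [g >> prI] and [up p]; postcomposing [g]
with [Ip f] postcomposes the uncurried morphism with [Id x f], whose second
component is composition with [f]. *)
Lemma etaInv_natural (C : Category) (p : Universe C) (bp : BinProducts C)
    (lcc : LCCStructure C) (X Y Y' : C) (f : Hom Y Y')
    (g : Hom X (Ip p bp lcc Y)) :
  etaInv p bp lcc Y' X (g >> fmap (Ip p bp lcc) f) =
  Dp_map p (Yo_map f) X (etaInv p bp lcc Y X g).
Proof.
pose v : Hom (sl (g >> prI p bp lcc Y)) (Ip_sl p bp lcc Y) :=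
  Build_SliceHom (A := sl (g >> prI p bp lcc Y)) (B := Ip_sl p bp lcc Y)
    (shom := g) eq_refl.
have e := etaInv_sl (v >> ihom_map (lcc_hom lcc (U p)) (sl (up p)) (slU_map p bp f)).
rewrite uncurryI_map in e.
apply: (eq_trans e).
rewrite (etaInv_sl v) /=; apply: (f_equal (existT _ _)).
by rewrite -!compA /prod_map pair2.
Qed.

Lemma eta_natural (C : Category) (p : Universe C) (bp : BinProducts C)
    (lcc : LCCStructure C) (X Y Y' : C) (f : Hom Y Y') (x : Dp p (Yo Y) X) :
  eta p bp lcc Y' X (Dp_map p (Yo_map f) X x) =
  eta p bp lcc Y X x >> fmap (Ip p bp lcc) f.
Proof.
have e := binvK (etaInv_bij p bp lcc Y X) x.
rewrite -{1}e -etaInv_natural.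
exact: (bijK (etaInv_bij p bp lcc Y' X)).
Qed.

Lemma etan_natural (C : Category) (p : Universe C) (bp : BinProducts C)
    (lcc : LCCStructure C) (n : nat) (Y Y' : C) (f : Hom Y Y') (X : C)
    (x : Dpn p n (Yo Y) X) :
  etan p bp lcc n Y' X (Dpn_map p n (Yo_map f) X x) =
  etan p bp lcc n Y X x >> fmap (Ipn p bp lcc n) f.
Proof.
elim: n X x => [|n IH] X x //.
rewrite [RHS]/= -eta_natural; congr (eta _ _ _ _ X _).
by apply: (f_equal (existT _ _)); exact: IH.
Qed.

(** * The isomorphisms u and tu *)

Lemma ccExt_inOb (C : Category) (p : Universe C) (ptC : FinalObject C)
    (G : CC p ptC) (F : Hom (int p ptC G) (U p)) :
  inOb 1 G (ccExt F).
Proof. by split=> //=; lia. Qed.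

Lemma inOb_ccExt (C : Category) (p : Universe C) (ptC : FinalObject C) (n : nat)
    (G T : CC p ptC) (F : Hom (int p ptC G) (U p)) :
  inOb n (ccExt F) T -> inOb (S n) G T.
Proof.
case=> h e; split; first by rewrite h /=; lia.
by change (ftn (S n) T) with (ftn n (ft T)); rewrite -ft_ftn e.
Qed.

Fixpoint u_inv (C : Category) (p : Universe C) (ptC : FinalObject C) (n : nat) :
    forall G : CC p ptC, Dpn p n (Yo (U p)) (int p ptC G) -> Ob (S n) G :=
  match n return forall G : CC p ptC,
      Dpn p n (Yo (U p)) (int p ptC G) -> Ob (S n) G with
  | 0 => fun G F => exist _ (ccExt F) (ccExt_inOb F)
  | S k => fun G x =>
      let T := u_inv (G := ccExt (projT1 x)) (projT2 x) in
      exist _ (proj1_sig T) (inOb_ccExt (proj2_sig T))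
  end.

Lemma u_invK (C : Category) (p : Universe C) (ptC : FinalObject C) (n : nat)
    (G : CC p ptC) (x : Dpn p n (Yo (U p)) (int p ptC G)) :
  u_fun (u_inv x) = x.
Proof.
elim: n G x => [|n IH] G x; first exact: u1_ext.
case: x => F x.
pose T := u_inv (G := ccExt F) x.
apply: (eq_trans (u_fun_S (F := F) (T' := T) _ _)) => //.
  exact: (proj2 (proj2_sig T)).
by rewrite IH.
Qed.

Lemma u_funK (C : Category) (p : Universe C) (ptC : FinalObject C) (n : nat)
    (G : CC p ptC) (T : Ob (S n) G) :
  u_inv (u_fun T) = T.
Proof.
elim: n G T => [|n IH] G T; apply: Ob_eq.
  case: T => T h; have [F E] := Ob1_ext h; subst T.
  by rewrite /= u1_ext.
have [F e] := Ob_over T; case: T e => T h e.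
rewrite (u_fun_S (F := F) (T' := exist _ T (Ob_at h e))) //=.
by rewrite IH.
Qed.

Definition u_bij (C : Category) (p : Universe C) (ptC : FinalObject C) (n : nat)
    (G : CC p ptC) : Bij (u p ptC n G) :=
  {| binv := @u_inv C p ptC n G; bijK := @u_funK C p ptC n G;
     binvK := @u_invK C p ptC n G |}.

(** A morphism [y] to [Ut] is a lift of [y >> up p], hence a section of the
pullback of [up p] along it. *)
Definition sec_of (C : Category) (p : Universe C) (X : C) (y : Hom X (Ut p)) :
    sec (pF (y >> up p)) :=
  exist _ (pb_lift (upb p (y >> up p)) (comp1f (y >> up p))) (pb_lift1 _ _).

Lemma sec_of_QF (C : Category) (p : Universe C) (X : C) (y : Hom X (Ut p)) :
  proj1_sig (sec_of y) >> QF (y >> up p) = y.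
Proof. exact: pb_lift2. Qed.

Lemma sec_QF_up (C : Category) (p : Universe C) (X : C) (F : Hom X (U p))
    (s : sec (pF F)) :
  proj1_sig s >> QF F >> up p = F.
Proof.
have e : pF F >> F = QF F >> up p := pb_comm (upb p F).
by rewrite -compA -e compA (proj2_sig s) comp1f.
Qed.

Fixpoint tu_inv (C : Category) (p : Universe C) (ptC : FinalObject C) (n : nat) :
    forall G : CC p ptC, Dpn p n (Yo (Ut p)) (int p ptC G) -> tOb n G :=
  match n return forall G : CC p ptC,
      Dpn p n (Yo (Ut p)) (int p ptC G) -> tOb n G with
  | 0 => fun G (y : Hom (int p ptC G) (Ut p)) =>
      existT (fun T : Ob 1 G => sec (pT (proj1_sig T)))
        (exist _ (ccExt (G := G) (y >> up p)) (ccExt_inOb (G := G) (y >> up p)))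
        (sec_of y)
  | S k => fun G x =>
      let o := tu_inv (G := ccExt (projT1 x)) (projT2 x) in
      existT (fun T : Ob (S (S k)) G => sec (pT (proj1_sig T)))
        (exist _ (proj1_sig (projT1 o)) (inOb_ccExt (proj2_sig (projT1 o))))
        (projT2 o)
  end.

Lemma tu_invK (C : Category) (p : Universe C) (ptC : FinalObject C) (n : nat)
    (G : CC p ptC) (x : Dpn p n (Yo (Ut p)) (int p ptC G)) :
  tu_fun (tu_inv x) = x.
Proof.
elim: n G x => [|n IH] G x.
  by apply: (eq_trans (tu1_ext _ _)); exact: sec_of_QF.
case: x => F x.
pose o := tu_inv (G := ccExt F) x.
apply: (eq_trans (tu_fun_S (F := F) (o' := o) _ _)) => //.
  exact: (proj2 (proj2_sig (projT1 o))).
by rewrite IH.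
Qed.

Lemma tu_funK (C : Category) (p : Universe C) (ptC : FinalObject C) (n : nat)
    (G : CC p ptC) (o : tOb n G) :
  tu_inv (tu_fun o) = o.
Proof.
elim: n G o => [|n IH] G o; apply: tOb_eq.
  case: o => [[T h] s]; have [F E] := Ob1_ext h; subst T.
  rewrite [tu_fun _](tu1_ext h s).
  apply: (@rawSec_eq C p ptC G _ F); first exact: sec_QF_up.
  exact: sec_of_QF.
have [F e] := Ob_over (projT1 o); case: o e => [[T h] s] e.
pose o' : tOb n (ccExt F) :=
  existT (fun T : Ob (S n) (ccExt F) => sec (pT (proj1_sig T)))
    (exist _ T (Ob_at h e)) s.
rewrite (tu_fun_S (F := F) (o' := o')) //.
exact: (f_equal (@traw C p ptC n (ccExt F)) (IH _ o')).
Qed.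

Definition tu_bij (C : Category) (p : Universe C) (ptC : FinalObject C) (n : nat)
    (G : CC p ptC) : Bij (tu p ptC n G) :=
  {| binv := @tu_inv C p ptC n G; bijK := @tu_funK C p ptC n G;
     binvK := @tu_invK C p ptC n G |}.

(** At the bottom of the recursion this says that the morphism to [Ut] given by
a section of the pullback along [F] lies over [F]; the outer layers only record
base objects, which [bd] keeps. *)
Lemma tu_bd (C : Category) (p : Universe C) (ptC : FinalObject C) (n : nat)
    (G : CC p ptC) (o : tOb n G) :
  Dpn_map p n (Yo_map (up p)) (int p ptC G) (tu_fun o) = u_fun (projT1 o).
Proof.
elim: n G o => [|n IH] G o.
  case: o => [[T h] s]; have [F E] := Ob1_ext h; subst T.
  rewrite [tu_fun _](tu1_ext h s) [u_fun _]u1_ext.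
  exact: (sec_QF_up s).
have [F e] := Ob_over (projT1 o); case: o e => [[T h] s] e.
pose o' : tOb n (ccExt F) :=
  existT (fun T : Ob (S n) (ccExt F) => sec (pT (proj1_sig T)))
    (exist _ T (Ob_at h e)) s.
rewrite (tu_fun_S (F := F) (o' := o')) //.
rewrite (u_fun_S (F := F) (T' := projT1 o')) //=.
by apply: (f_equal (existT _ F)); exact: (IH _ o').
Qed.

(** * The isomorphisms mu and tmu *)

(* The index n = 0, 1, ... of mu, tmu and bd stands for n + 1 in the usual
   numbering, so the theorem covers all indices >= 1. *)
Theorem mainTheorem10 (C : Category) (p : Universe C) (ptC : FinalObject C)
    (bp : BinProducts C) (lcc : LCCStructure C) (n : nat) :
  is_psh_iso (mu p ptC bp lcc n) /\
  is_psh_iso (tmu p ptC bp lcc n) /\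
  tmu p ptC bp lcc n
    >>> pre_map (int p ptC) (Yo_map (fmap (Ipn p bp lcc n) (up p)))
  = bd p ptC n >>> mu p ptC bp lcc n.
Proof.
split; [|split].
- apply: psh_iso_comp; first exact: (bij_psh_iso (@u_bij C p ptC n)).
  by apply: pre_map_iso; exact: etan_iso.
- apply: psh_iso_comp; first exact: (bij_psh_iso (@tu_bij C p ptC n)).
  by apply: pre_map_iso; exact: etan_iso.
- apply: PshMor_eq => G o /=.
  by rewrite -tu_bd etan_natural.
Qed.
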